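(* Let $(X,D,K)$ be a strong $b$-metric space. Then: (1) $(X,D,K)$ has a completion $(X^*,D^*,K)$ (with the same constant $K$). (2) The completion of $(X,D,K)$ is unique in the sense that if $(X_1^*,D_1^*,K_1)$ and $(X_2^*,D_2^*,K_2)$ are two completions of $(X,D,K)$, then there is a bijective isometry $\varphi: X_1^* \to X_2^*$ which restricts to the identity on $X$ (where $X$ is identified with its isometric images in $X_1^*$ and $X_2^*$; that is, $\varphi(f_1(x)) = f_2(x)$ for all $x\in X$, where $f_1: X\to X_1^*$ and $f_2: X\to X_2^*$ are the isometries with dense image belonging to the two completions).
   Context: A $b$-metric space is a triple $(X,D,K)$ where $X$ is a non-empty set, $K>0$ is a real number, and $D: X\times X\to[0,+\infty)$ is a function such that for all $x,y,z\in X$: (i) $D(x,y)=0$ if and only if $x=y$; (ii) $D(x,y)=D(y,x)$; (iii) $D(x,z)\le K[D(x,y)+D(y,z)]$. A strong $b$-metric space is a triple $(X,D,K)$ where $X$ is a non-empty set, $K\ge 1$, and $D: X\times X\to[0,+\infty)$ satisfies (i), (ii) and, for all $x,y,z\in X$, $D(x,z)\le D(x,y)+K D(y,z)$. Every strong $b$-metric space $(X,D,K)$ is a $b$-metric space with the same constant $K$. In a $b$-metric space $(X,D,K)$, a sequence $\{x_n\}$ converges to $x$ if $\lim_{n\to\infty}D(x_n,x)=0$, and is Cauchy if $\lim_{n,m\to\infty}D(x_n,x_m)=0$. The space is complete if every Cauchy sequence is convergent. A $b$-metric space is always regarded as a topological space with the topology induced by its convergence, and $\overline{A}$ denotes the closure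 of $A$ in this topology. A map $f: X\to Y$ from a $b$-metric space $(X,D,K)$ into a $b$-metric space $(Y,D',K')$ is an isometry if $D'(f(x),f(y))=D(x,y)$ for all $x,y\in X$ (surjectivity is not required). A $b$-metric space $(X^*,D^*,K^* )$ is called a completion of the $b$-metric space $(X,D,K)$ if $(X^*,D^*,K^* )$ is complete and there exists an isometry $f: X\to X^*$ such that $\overline{f(X)}=X^*$.
   Formalization: In (2) both completions are assumed to be strong b-metric spaces (any constants): among mere b-metric completions uniqueness fails, e.g. {1/n} completed by a point 0 with D(0,1/n)=1/n or D(0,1/n)=2/n. *)

(* Defs.v *)
From HB Require Import structures.
From mathcomp Require Import all_boot all_order all_algebra.
From mathcomp Require Import all_classical all_reals all_analysis.
Set Implicit Arguments.
Unset Strict Implicit.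
Unset Printing Implicit Defensive.
Import Order.TTheory GRing.Theory Num.Theory.
Import numFieldNormedType.Exports.
Local Open Scope classical_set_scope.
Local Open Scope ring_scope.

Definition b_metric (R : realType) (T : Type) (D : T -> T -> R) (K : R) : Prop :=
  [/\ 0 < K,
      forall x y, 0 <= D x y,
      forall x y, D x y = 0 <-> x = y,
      forall x y, D x y = D y x &
      forall x y z, D x z <= K * (D x y + D y z)].

Definition strong_b_metric (R : realType) (T : Type) (D : T -> T -> R) (K : R) :
    Prop :=
  [/\ 1 <= K,
      forall x y, 0 <= D x y,
      forall x y, D x y = 0 <-> x = y,
      forall x y, D x y = D y x &
      forall x y z, D x z <= D x y + K * D y z].

Lemma strong_b_metric_b_metric (R : realType) (T : Type) (D : T -> T -> R)
  (K : R) : strong_b_metric D K -> b_metric D K.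
Proof.
move=> [K1 D0 Deq Dsym Dtri]; split=> //; first exact: lt_le_trans ltr01 K1.
move=> x y z; apply: (le_trans (Dtri x y z)).
by rewrite mulrDr lerD2r ler_peMl.
Qed.

Record bMetricSpace (R : realType) := BMetricSpace {
  carrier :> Type;
  dist : carrier -> carrier -> R;
  bconst : R;
  carrier_inhabited : inhabited carrier;
  dist_b_metric : b_metric dist bconst }.

Arguments dist {R b}.

(* By strong_b_metric_b_metric, asking this of a bMetricSpace costs nothing:
   every triple (T, D, K) with strong_b_metric D K underlies such a space. *)
Definition strong (R : realType) (X : bMetricSpace R) : Prop :=
  strong_b_metric (@dist R X) (bconst X).

Definition converges (R : realType) (X : bMetricSpace R) (u : nat -> X) (x : X) :
    Prop :=
  (fun n => dist (u n) x) @ \oo --> (0 : R).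

Definition cauchy_seq (R : realType) (X : bMetricSpace R) (u : nat -> X) : Prop :=
  (fun p : nat * nat => dist (u p.1) (u p.2)) @ (\oo, \oo) --> (0 : R).

Definition complete_space (R : realType) (X : bMetricSpace R) : Prop :=
  forall u : nat -> X, cauchy_seq u -> exists x, converges u x.

(* The topology induced by the convergence of sequences. Balls of a b-metric
   need not be open, so it is not defined as the topology generated by balls. *)
Definition seq_open (R : realType) (X : bMetricSpace R) : set (set X) :=
  [set U | forall (u : nat -> X) (x : X), U x -> converges u x ->
             \forall n \near \oo, U (u n)].

Lemma seq_openT (R : realType) (X : bMetricSpace R) : @seq_open R X setT.
Proof. by move=> u x _ _; apply: nearW. Qed.

Lemma seq_openI (R : realType) (X : bMetricSpace R) : setI_closed (@seq_open R X).
Proof.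
move=> A B oA oB u x [Ax Bx] ux.
by apply: filterI; [exact: oA ux | exact: oB ux].
Qed.

Lemma seq_open_bigcup (R : realType) (X : bMetricSpace R) (I : Type)
    (f : I -> set X) :
  (forall i, seq_open (f i)) -> seq_open (\bigcup_i f i).
Proof.
move=> of_ u x [i _ fix_] ux.
by apply: filterS (of_ i u x fix_ ux) => n; exists i.
Qed.

HB.instance Definition _ (R : realType) (X : bMetricSpace R) :=
  gen_eqMixin (carrier X).
HB.instance Definition _ (R : realType) (X : bMetricSpace R) :=
  gen_choiceMixin (carrier X).
HB.instance Definition _ (R : realType) (X : bMetricSpace R) :=
  isOpenTopological.Build (carrier X) (@seq_openT R X) (@seq_openI R X)
    (@seq_open_bigcup R X).

Definition is_isometry (R : realType) (X Y : bMetricSpace R) (f : X -> Y) : Prop :=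
  forall x y, dist (f x) (f y) = dist x y.

Definition dense_isometry (R : realType) (X Y : bMetricSpace R) (f : X -> Y) :
    Prop :=
  is_isometry f /\ closure (range f) = [set: Y].

(* Xs need not be strong here, even when X is. Among completions that are only
   b-metric, uniqueness fails: {1/n} with the usual metric is completed by adding
   a point 0 with either dist 0 (1/n) = 1/n or dist 0 (1/n) = 2/n; the second
   space satisfies b_metric with K = 2 but is not strong for any K. *)
Definition is_completion (R : realType) (X Xs : bMetricSpace R) : Prop :=
  complete_space Xs /\ exists f : X -> Xs, dense_isometry f.

(* Main.v *)
Require Import Defs.
From mathcomp Require Import all_boot all_order all_algebra.
From mathcomp Require Import all_classical all_reals all_analysis.

(** The strong triangle inequality makes the distance jointly continuous:
    |D(x,y) - D(x',y')| <= K (D(x,x') + D(y,y')).  Hence open balls are open and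
    D(u_n,v_n) converges whenever u and v are Cauchy.  A point of the completion
    is encoded by its distance function z |-> lim D(u_n,z) on X, for u Cauchy;
    such a function determines u up to D(u_n,v_n) -> 0, so no quotient is needed.
    For uniqueness, isometries into complete spaces extend along dense
    isometries, and isometries that agree on a dense subset are equal. *)

Set Implicit Arguments.
Unset Strict Implicit.
Unset Printing Implicit Defensive.
Import Order.TTheory GRing.Theory Num.Theory.
Import numFieldNormedType.Exports.
Local Open Scope classical_set_scope.
Local Open Scope ring_scope.

(** * Limits of real functions and sequences *)

Section RealSequences.
Context {R : realType}.

Lemma squeeze_cvg0 (T : Type) (F : set_system T) {FF : Filter F} (f g : T -> R) :
  (forall x, `|f x| <= g x) -> g @ F --> (0 : R) -> f @ F --> (0 : R).
Proof.
move=> fg g0; apply/norm_cvg0P; apply: squeeze_cvgr (cvg_cst (0 : R)) g0.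
by apply: nearW => x; rewrite normr_ge0 fg.
Qed.

Lemma cvg_sub0r (T : Type) (F : set_system T) {FF : Filter F} (f g : T -> R)
    (l : R) :
  (fun t => f t - g t) @ F --> (0 : R) -> g @ F --> l -> f @ F --> l.
Proof.
move=> fg gl; have <- : (fun t => f t - g t) \+ g = f.
  by apply/funext => t /=; rewrite subrK.
by rewrite -[l]add0r; exact: cvgD.
Qed.

Lemma cvg_sub0l (T : Type) (F : set_system T) {FF : Filter F} (f g : T -> R)
    (l : R) :
  (fun t => f t - g t) @ F --> (0 : R) -> f @ F --> l -> g @ F --> l.
Proof.
move=> fg; apply: cvg_sub0r; rewrite -oppr0.
by under eq_fun do rewrite -opprB; exact: cvgN.
Qed.

Lemma cauchy_sub_cvgn (s : nat -> R) :
  (fun p : nat * nat => s p.1 - s p.2) @ (\oo, \oo) --> (0 : R) -> cvgn s.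
Proof.
move=> /cvgr0Pnorm_lt s0; apply/cauchy_cvgP/cauchy_ballP => e e0.
have [[P Q] /= [nP nQ] PQ] := s0 _ e0.
(* The Cauchy criterion concerns the image filter of [s], so the index sets [P] and [Q] are pushed
   forward along [s]. *)
exists (s @` P, s @` Q) => /=.
  by split; [apply: filterS nP | apply: filterS nQ] => n ?; exists n.
by move=> [_ _] /= [[n Pn <-] [m Qm <-]]; exact: (PQ (n, m)).
Qed.

End RealSequences.

(** * Convergence and topology in a strong b-metric space *)

Section StrongSpace.
Context {R : realType} {X : bMetricSpace R}.
Hypothesis hX : strong X.
Local Notation K := (bconst X).

Lemma dist_ge0 (x y : X) : 0 <= dist x y.
Proof. by case: hX. Qed.

Lemma dist_eq0 (x y : X) : dist x y = 0 -> x = y.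
Proof. by case: hX => _ _ + _ _ => /(_ x y)[]. Qed.

Lemma distxx (x : X) : dist x x = 0.
Proof. by case: hX => _ _ + _ _ => /(_ x x)[_]; exact. Qed.

Lemma dist_sym (x y : X) : dist x y = dist y x.
Proof. by case: hX. Qed.

Lemma dist_tri (x y z : X) : dist x z <= dist x y + K * dist y z.
Proof. by case: hX. Qed.

(** The endpoints are replaced one at a time, with symmetry placing the factor [K] on the
    displacement each time, so the main term keeps coefficient 1. *)
Lemma dist_quad (x y x' y' : X) :
  dist x y <= dist x' y' + K * (dist x x' + dist y y').
Proof.
apply: le_trans (dist_tri _ y' _) _; rewrite (dist_sym y' y) mulrDr addrA lerD2r.
by rewrite (dist_sym x y') (dist_sym x' y') (dist_sym x x'); exact: dist_tri.
Qed.

Lemma dist_sub_le (x y x' y' : X) :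
  `|dist x y - dist x' y'| <= K * (dist x x' + dist y y').
Proof.
rewrite ler_norml lerNl opprB !lerBlDl dist_quad andbT.
by rewrite (dist_sym x x') (dist_sym y y') dist_quad.
Qed.

(** The filter is arbitrary so as to cover both sequences and the pairs of indices in
    [cauchy_seq]. *)
Lemma dist_sub_cvg0 (T : Type) (F : set_system T) {FF : Filter F}
    (u u' v v' : T -> X) :
  (fun t => dist (u t) (u' t)) @ F --> (0 : R) ->
  (fun t => dist (v t) (v' t)) @ F --> (0 : R) ->
  (fun t => dist (u t) (v t) - dist (u' t) (v' t)) @ F --> (0 : R).
Proof.
move=> uu' vv'.
apply: squeeze_cvg0 => [t|]; first exact: dist_sub_le.
rewrite -(mulr0 K) -[X in K * X]addr0.
by apply: cvgM; [exact: cvg_cst|exact: cvgD].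
Qed.

Lemma dist_cvgxx (T : Type) (F : set_system T) {FF : Filter F} (u : T -> X) :
  (fun t => dist (u t) (u t)) @ F --> (0 : R).
Proof. by under eq_fun do rewrite distxx; exact: cvg_cst. Qed.

Lemma converges_dist (u v : nat -> X) (x y : X) :
  converges u x -> converges v y ->
  (fun n => dist (u n) (v n)) @ \oo --> dist x y.
Proof.
move=> ux vy; apply: cvg_sub0r; first exact: dist_sub_cvg0 ux vy.
exact: cvg_cst.
Qed.

Lemma converges_unique (u : nat -> X) (x y : X) :
  converges u x -> converges u y -> x = y.
Proof.
move=> ux uy; apply: dist_eq0.
apply: cvg_unique (converges_dist ux uy) _ => //; exact: dist_cvgxx.
Qed.

Lemma converges_cauchy (u : nat -> X) (x : X) : converges u x -> cauchy_seq u.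
Proof.
move=> ux; apply: cvg_sub0r.
  apply: (@dist_sub_cvg0 _ _ _ _ (fun=> x) _ (fun=> x)).
    exact: (cvg_comp fst (fun n => dist (u n) x) cvg_fst ux).
  exact: (cvg_comp snd (fun n => dist (u n) x) cvg_snd ux).
exact: dist_cvgxx.
Qed.

(** The differences D(u_n,v_n) - D(u_m,v_m) are at most K (D(u_n,u_m) + D(v_n,v_m)) in absolute
    value, so the real sequence is Cauchy. *)
Lemma cauchy_dist_cvgn (u v : nat -> X) :
  cauchy_seq u -> cauchy_seq v -> cvgn (fun n => dist (u n) (v n)).
Proof. by move=> cu cv; apply: cauchy_sub_cvgn; exact: dist_sub_cvg0 cu cv. Qed.

Lemma cauchy_seq_cst (x : X) : cauchy_seq (fun=> x).
Proof. exact: dist_cvgxx. Qed.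

Lemma cauchy_seq_near (u : nat -> X) (e : R) : cauchy_seq u -> 0 < e ->
  \forall m \near \oo, \forall n \near \oo, dist (u n) (u m) < e.
Proof.
move=> /cvgr0Pnorm_lt cu e0; have [[P Q] /= [nP nQ] PQ] := cu _ e0.
apply: filterS nQ => m Qm; apply: filterS nP => n Pn.
by rewrite -[ltLHS]ger0_norm ?dist_ge0 //; exact: (PQ (n, m)).
Qed.

Lemma ball_seq_open (x : X) (e : R) : seq_open [set y : X | dist y x < e].
Proof.
move=> u y yx uy; apply: (@cvgr_lt _ _ _ _ _ (dist y x)) yx.
by apply: (converges_dist uy); exact: dist_cvgxx.
Qed.

(** Since balls are open, a point of the closure has points of [A] in its balls of radius 1/(n+1),
    and these form the sequence. *)
Lemma seq_closure (A : set X) (x : X) :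
  closure A x <-> exists u : nat -> X, (forall n, A (u n)) /\ converges u x.
Proof.
split=> [clA|[u [Au ux]] B].
  have /choice[u uP] : forall n : nat, exists y, A y /\ dist y x < n.+1%:R^-1.
    move=> n; have [|y [Ay yx]] := clA [set y | dist y x < n.+1%:R^-1].
      apply: open_nbhs_nbhs; split; first exact: ball_seq_open.
      by rewrite /= distxx invr_gt0.
    by exists y.
  exists u; split=> [n|]; first by case: (uP n).
  apply: squeeze_cvg0 (@cvg_harmonic R) => n.
  by rewrite ger0_norm ?dist_ge0 // ltW //; case: (uP n).
rewrite nbhsE => -[U [oU Ux] UB].
have [N _ /(_ N (leqnn N)) UuN] := oU u x Ux ux.
by exists (u N); split; [exact: Au|exact: UB].
Qed.

End StrongSpace.

(** * Isometries, density and completeness *)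

Section Isometries.
Context {R : realType}.
Implicit Types X Y Z : bMetricSpace R.

Lemma isometry_cauchy X Y (f : X -> Y) (u : nat -> X) :
  is_isometry f -> cauchy_seq (f \o u) <-> cauchy_seq u.
Proof. by move=> fI; rewrite /cauchy_seq; under eq_fun do rewrite /= fI. Qed.

Lemma isometry_converges X Y (f : X -> Y) (u : nat -> X) (x : X) :
  is_isometry f -> converges (f \o u) (f x) <-> converges u x.
Proof. by move=> fI; rewrite /converges; under eq_fun do rewrite /= fI. Qed.

Lemma dense_seq X Y (f : X -> Y) (y : Y) :
  strong Y -> closure (range f) = [set: Y] ->
  exists u : nat -> X, converges (f \o u) y.
Proof.
move=> hY fD; have /(seq_closure hY)[v [vf vy]] : closure (range f) y.
  by rewrite fD.
have /choice[u uv] : forall n, exists x, f x = v n.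
  by move=> n; have [x _ <-] := vf n; exists x.
by exists u; rewrite (_ : f \o u = v) //; apply/funext.
Qed.

Lemma isometry_eq X Y Z (f : X -> Y) (phi psi : Y -> Z) :
  strong Y -> strong Z -> closure (range f) = [set: Y] ->
  is_isometry phi -> is_isometry psi ->
  (forall x, phi (f x) = psi (f x)) -> phi =1 psi.
Proof.
move=> hY hZ fD phiI psiI E y; have [u uy] := dense_seq y hY fD.
apply: (@converges_unique _ _ hZ (phi \o (f \o u))).
  by apply/isometry_converges.
rewrite (_ : phi \o (f \o u) = psi \o (f \o u)).
  by apply/isometry_converges.
by apply/funext => n /=; exact: E.
Qed.

(** The image of y is the limit of g(u_n) for a chosen u with f(u_n) -> y; it exists because u
    inherits the Cauchy property from f(u_n). *)
Lemma isometry_extension X Y Z (f : X -> Y) (g : X -> Z) :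
  strong Y -> strong Z -> complete_space Z ->
  dense_isometry f -> is_isometry g ->
  exists phi : Y -> Z, is_isometry phi /\ forall x, phi (f x) = g x.
Proof.
move=> hY hZ cZ [fI fD] gI.
have /choice[phi phiP] : forall y, exists z, exists u : nat -> X,
    converges (f \o u) y /\ converges (g \o u) z.
  move=> y; have [u uy] := dense_seq y hY fD.
  have /cZ[z uz] : cauchy_seq (g \o u).
    apply/(isometry_cauchy u gI)/(isometry_cauchy u fI).
    exact: converges_cauchy hY _ _ uy.
  by exists z, u.
exists phi; split=> [y y'|x].
  have [u [uy uphi]] := phiP y; have [v [vy' vphi]] := phiP y'.
  have := converges_dist hZ uphi vphi; under eq_fun do rewrite /= gI -fI.
  by move=> /cvg_unique; apply=> //; exact: converges_dist hY _ _ _ _ uy vy'.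
(* The sequence chosen for [f x] need not be constant, but it converges to x, so g(u_n) tends to
   both [phi (f x)] and [g x]. *)
have [u [ux uphi]] := phiP (f x).
apply: (converges_unique hZ uphi).
by apply/(isometry_converges u x gI)/(isometry_converges u x fI).
Qed.

(** A Cauchy sequence v in Y is approximated by f(u_n) within 1/(n+1); then u is Cauchy, and the
    limit of f(u_n) is also that of v. *)
Lemma complete_of_dense X Y (f : X -> Y) : strong Y -> is_isometry f ->
  closure (range f) = [set: Y] ->
  (forall u, cauchy_seq u -> exists y, converges (f \o u) y) ->
  complete_space Y.
Proof.
move=> hY fI fD fC v cv.
have /choice[u uv] : forall n, exists x, dist (f x) (v n) < n.+1%:R^-1.
  move=> n; have [w /cvgr_lt wv] := dense_seq (v n) hY fD.
  have [|N _ /(_ N (leqnn N))] := wv n.+1%:R^-1; first by rewrite invr_gt0.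
  by exists (w N).
have uv0 : (fun n => dist (f (u n)) (v n)) @ \oo --> (0 : R).
  apply: squeeze_cvg0 (@cvg_harmonic R) => n.
  by rewrite ger0_norm ?(dist_ge0 hY) // ltW.
have /fC[y uy] : cauchy_seq u.
  apply/(isometry_cauchy u fI); apply: cvg_sub0r cv.
  apply: (dist_sub_cvg0 hY).
    exact: (cvg_comp fst (fun n => dist (f (u n)) (v n)) cvg_fst uv0).
  exact: (cvg_comp snd (fun n => dist (f (u n)) (v n)) cvg_snd uv0).
exists y; apply: cvg_sub0l uy; apply: (dist_sub_cvg0 hY) => //.
exact: dist_cvgxx.
Qed.

End Isometries.

(** * Construction of the completion *)

Section Completion.
Context {R : realType} {X : bMetricSpace R}.
Hypothesis hX : strong X.
Local Notation K := (bconst X).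

Definition represents (u : nat -> X) (g : X -> R) : Prop :=
  cauchy_seq u /\ forall z, (fun n => dist (u n) z) @ \oo --> g z.

Definition cpoint : Type := {g : X -> R | exists u, represents u g}.

(** Fixing one representative by choice makes [cdist] a function with no well-definedness to
    check. *)
Definition crepr (g : cpoint) : nat -> X := sval (cid (proj2_sig g)).

Definition cdist (g h : cpoint) : R := limn (fun n => dist (crepr g n) (crepr h n)).

Lemma creprP (g : cpoint) : represents (crepr g) (sval g).
Proof. exact: (svalP (cid (proj2_sig g))). Qed.

Lemma cauchy_represents (u : nat -> X) : cauchy_seq u -> exists g, represents u g.
Proof.
move=> cu; exists (fun z => limn (fun n => dist (u n) z)); split=> // z.
exact: (cauchy_dist_cvgn hX cu (cauchy_seq_cst hX z)).
Qed.

(** The value g(u_m) is the limit over n of D(u_n,u_m), which is small for large m. Through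
    [cdist_embed] this says that the embedded u_m tend to g. *)
Lemma represents_cvg0 (u : nat -> X) (g : X -> R) :
  represents u g -> (fun n => g (u n)) @ \oo --> (0 : R).
Proof.
move=> [cu ug]; apply/cvgr0Pnorm_le => e e0.
apply: filterS (cauchy_seq_near hX cu e0) => m um.
apply: cvgr_to_le (cvg_norm (ug (u m))) _.
by apply: filterS um => n /ltW; rewrite ger0_norm // (dist_ge0 hX).
Qed.

(** The [limn] in [cdist] is thus a genuine limit, not a default value. *)
Lemma cdist_cvg (g h : cpoint) :
  (fun n => dist (crepr g n) (crepr h n)) @ \oo --> cdist g h.
Proof. exact: (cauchy_dist_cvgn hX (creprP g).1 (creprP h).1). Qed.

Arguments cdist_cvg g h [t] _.

Lemma cdist_eq0 (g h : cpoint) : cdist g h = 0 <-> g = h.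
Proof.
split=> [gh0|->]; last first.
  by apply: cvg_unique (cdist_cvg h h) _ => //; exact: dist_cvgxx.
(* Proof irrelevance reduces equality of points to equality of distance functions. *)
suff : sval g = sval h.
  by case: g h {gh0} => [g gP] [h hP] /= E; apply: eq_exist.
apply/funext => z; apply: cvg_unique ((creprP g).2 z) _ => //.
apply: cvg_sub0r ((creprP h).2 z); apply: (dist_sub_cvg0 hX).
  by rewrite -gh0; exact: cdist_cvg.
exact: dist_cvgxx.
Qed.

Lemma cdist_strong : strong_b_metric cdist K.
Proof.
split.
- by case: hX.
- move=> g h; apply: cvgr_to_ge (cdist_cvg g h) _.
  by apply: nearW => n; exact: dist_ge0.
- exact: cdist_eq0.
- move=> g h; rewrite /cdist; under eq_fun do rewrite (dist_sym hX).
  by [].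
- move=> g h k; apply: ler_cvg_to (cdist_cvg g k) _ _.
    by apply: cvgD (cdist_cvg g h) (cvgM (cvg_cst K) (cdist_cvg h k)).
  by apply: nearW => n; exact: dist_tri.
Qed.

Lemma represents_dist (x : X) : represents (fun=> x) (dist x).
Proof. by split=> [|z]; [exact: cauchy_seq_cst|exact: cvg_cst]. Qed.

Definition embed (x : X) : cpoint :=
  exist _ (dist x) (ex_intro _ (fun=> x) (represents_dist x)).

Lemma cdist_embed (x : X) (g : cpoint) : cdist (embed x) g = sval g x.
Proof.
apply: cvg_unique (cdist_cvg (embed x) g) _ => //.
apply: cvg_sub0r; last first.
  by have := (creprP g).2 x; under eq_fun do rewrite dist_sym //; exact.
apply: (dist_sub_cvg0 hX); last exact: dist_cvgxx.
(* The chosen representative of [embed x] may differ from the constant sequence; evaluating its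
   distance function at x shows that it converges to x. *)
by have := (creprP (embed x)).2 x; rewrite /= (distxx hX).
Qed.

Lemma cpoint_inhabited : inhabited cpoint.
Proof. by case: (carrier_inhabited X) => x; constructor; exact: embed x. Qed.

Definition completion : bMetricSpace R :=
  BMetricSpace cpoint_inhabited (strong_b_metric_b_metric cdist_strong).

Lemma completion_strong : strong completion.
Proof. exact: cdist_strong. Qed.

Lemma embed_isometry : @is_isometry R X completion embed.
Proof. by move=> x y; rewrite (dist_sym hX x); exact: cdist_embed. Qed.

Lemma embed_converges (u : nat -> X) (g : cpoint) : represents u (sval g) ->
  @converges R completion (embed \o u) g.
Proof.
move=> /represents_cvg0; rewrite /converges.
by under [X in _ -> X @ _ --> _]eq_fun do rewrite /= cdist_embed.
Qed.

Lemma embed_dense : closure (range (embed : X -> completion)) = [set: completion].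
Proof.
rewrite -subTset => g _; apply/(seq_closure completion_strong).
exists (embed \o crepr g); split=> [n|]; first by exists (crepr g n).
exact: embed_converges (creprP g).
Qed.

Lemma completion_complete : complete_space completion.
Proof.
apply: (complete_of_dense completion_strong embed_isometry embed_dense) => u cu.
have [g ug] := cauchy_represents cu.
by exists (exist _ g (ex_intro _ u ug) : cpoint); exact: embed_converges.
Qed.

End Completion.

Theorem theorem2p2 (R : realType) (X : bMetricSpace R) (hX : strong X) :
  (exists Xs : bMetricSpace R,
     [/\ strong Xs, bconst Xs = bconst X & is_completion X Xs])
  /\
  (forall (X1 X2 : bMetricSpace R),
     strong X1 -> strong X2 -> is_completion X X1 -> is_completion X X2 ->
     forall (f1 : X -> X1) (f2 : X -> X2),
       dense_isometry f1 -> dense_isometry f2 ->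
       exists phi : X1 -> X2,
         [/\ bijective phi, is_isometry phi & forall x : X, phi (f1 x) = f2 x]).
Proof.
split=> [|X1 X2 h1 h2 [c1 _] [c2 _] f1 f2 d1 d2].
  exists (completion hX); split=> //; first exact: completion_strong.
  split; first exact: completion_complete.
  by exists (embed hX); split; [exact: embed_isometry|exact: embed_dense].
have [phi [phiI phif]] := isometry_extension h1 h2 c2 d1 d2.1.
have [psi [psiI psif]] := isometry_extension h2 h1 c1 d2 d1.1.
(* Each composite of [phi] and [psi] is an isometry fixing a dense image of X, hence the
   identity. *)
exists phi; split=> //; exists psi.
  apply: (isometry_eq (phi := psi \o phi) (psi := id) h1 h1 d1.2) => //.
    by move=> x y /=; rewrite psiI phiI.
  by move=> x /=; rewrite phif psif.
apply: (isometry_eq (phi := phi \o psi) (psi := id) h2 h2 d2.2) => //.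
  by move=> x y /=; rewrite phiI psiI.
by move=> x /=; rewrite psif phif.
Qed.
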